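(* Let $\phi(x)=\exp(-x^2)$ for $x\in\mathbb{R}$. Let $n\in\mathbb{N}$ and $\lambda\in(0,1)$ satisfy $$ n>N_0:=C_0\,\lambda\exp\left(\frac{\pi^2}{2\lambda^2}\right),\qquad C_0:=\frac{1280}{3\pi}. $$ Then there exists $P\in E_n(\lambda)$, not identically zero, such that $$ \frac{\|P'\|_\infty}{\|P\|_\infty}\ \ge\ \frac{\pi^2}{2^{10}\lambda}. $$
   Context: With $\phi(x)=\exp(-x^2)$, for $\lambda>0$ and $n\in\mathbb{N}$, $$E_n(\lambda)=\Big\{x\mapsto\sum_{k=-n}^{n}b_k\,\phi(x+\lambda k)\ :\ b_k\in\mathbb{R},\ k=-n,\dots,n\Big\}.$$ $\|\cdot\|_\infty$ is the supremum norm on $\mathbb{R}$. *)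

(* Defs.v *)
From mathcomp Require Import all_boot all_order all_algebra.
From mathcomp Require Import all_classical all_reals all_analysis.
Import Order.TTheory GRing.Theory Num.Theory.
Import numFieldNormedType.Exports.

Set Implicit Arguments.
Unset Strict Implicit.
Unset Printing Implicit Defensive.

Local Open Scope classical_set_scope.
Local Open Scope ring_scope.

Definition phi {R : realType} (x : R) : R := expR (- x ^+ 2).

(* The index k = -n, ..., n is written k = i - n with 0 <= i <= 2n; the values
   of b outside [-n, n] play no role. *)
Definition gauss_span {R : realType} (n : nat) (lambda : R) : set (R -> R) :=
  [set P | exists b : int -> R,
     P = fun x => \sum_(i < (2 * n).+1)
           b (i%:Z - n%:Z) * phi (x + lambda * (i%:Z - n%:Z)%:~R)].

(* The supremum norm on the whole line, +oo for unbounded functions. *)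
Definition sup_norm {R : realType} (f : R -> R) : \bar R :=
  ereal_sup (range (fun x => `|f x|%:E)).

(* Main.v *)
(* E_n(lambda) consists of the functions phi(x) e^(2 lambda n x) Q(y) with
   y = e^(-2 lambda x) and Q a real polynomial of degree at most 2n, so 2n zeros
   can be prescribed; put them at the odd multiples of lambda in
   (-2 lambda n, 2 lambda n).  Beyond the last zero, the gaussian outweighs the
   growth of the product: for x >= lambda (2n + 3), translating x by -2 lambda
   does not decrease |P(x)|, as soon as lambda^3 n >= 1, which is much weaker
   than n > N_0.  Hence every value |P(x)| is at most |P(y)| for some y within
   4 lambda of a zero of P, and the mean value theorem yields
   ||P|| <= 4 lambda ||P'||; finally 4 pi^2 <= 2^10. *)
Require Import Defs.
From mathcomp Require Import all_boot all_order all_algebra.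
From mathcomp Require Import all_classical all_reals all_analysis.
From mathcomp Require Import ring lra zify.
Import Order.TTheory GRing.Theory Num.Theory.
Import numFieldNormedType.Exports.

Local Open Scope classical_set_scope.
Local Open Scope ring_scope.

(** * Differentiability and boundedness of the functions in the span *)

Lemma phi_ge0 {R : realType} (x : R) : 0 <= phi x.
Proof. exact: expR_ge0. Qed.

Lemma phi_le1 {R : realType} (x : R) : phi x <= 1.
Proof. by rewrite /phi -expR0 ler_expR oppr_le0 sqr_ge0. Qed.

Lemma phiN {R : realType} (x : R) : phi (- x) = phi x.
Proof. by rewrite /phi sqrrN. Qed.

Lemma gauss_span_derivable {R : realType} {n : nat} {lambda : R} {P : R -> R}
  (x : R) : gauss_span n lambda P -> derivable P x 1.
Proof.
case=> b ->.
have -> : (fun x : R => \sum_(i < (2 * n).+1)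
           b (i%:Z - n%:Z) * phi (x + lambda * (i%:Z - n%:Z)%:~R)) =
   \sum_(i < (2 * n).+1) (fun x : R =>
           b (i%:Z - n%:Z) * phi (x + lambda * (i%:Z - n%:Z)%:~R)).
  by apply/funext => y; rewrite fct_sumE.
apply: derivable_sum => i.
rewrite /phi.
exact: ex_derive.
Qed.

Lemma gauss_span_bounded {R : realType} {n : nat} {lambda : R} {P : R -> R} :
  gauss_span n lambda P -> exists M : R, forall x, `|P x| <= M.
Proof.
case=> b ->; exists (\sum_(i < (2 * n).+1) `|b (i%:Z - n%:Z)|) => x.
apply: le_trans (ler_norm_sum _ _ _) _; apply: ler_sum => i _.
by rewrite normrM ler_piMr// ger0_norm ?phi_ge0 ?phi_le1.
Qed.

(** * From nearby zeros to a lower bound on the derivative *)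

(** The mean value theorem between [y] and [z] gives ||P|| <= D ||P'||. The bound [B] and the
    nonzero value make ||P|| a positive real, so the quotient in the extended reals is the genuine
    one. *)
Lemma sup_norm_le_derive {R : realType} {P : R -> R} {D c B : R} :
  0 <= c -> c * D <= 1 -> (forall x, derivable P x 1) ->
  (forall x, `|P x| <= B) -> (exists x, P x != 0) ->
  (forall x, exists y z, [/\ `|P x| <= `|P y|, P z = 0 & `|y - z| <= D]) ->
  (c%:E <= sup_norm (derive1 P) / sup_norm P)%E.
Proof.
move=> c0 cD dP PB [x0 Px0] Pnear.
have supP x : (`|P x|%:E <= sup_norm P)%E.
  by apply: ereal_sup_ubound; exists x.
have supB : (sup_norm P <= B%:E)%E.
  by apply: ge_ereal_sup => _ [x _ <-]; rewrite lee_fin.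
have supP' x : (`|derive1 P x|%:E <= sup_norm (derive1 P))%E.
  by apply: ereal_sup_ubound; exists x.
have N0 : (0 < sup_norm P)%E.
  by apply: lt_le_trans (supP x0); rewrite lte_fin normr_gt0.
case NE : (sup_norm P) N0 supB => [N||]// N0 _.
rewrite lte_fin in N0.
rewrite inver gt_eqF// lee_pdivlMr// -EFinM.
(* If ||P'|| is infinite the inequality is trivial. *)
case ME : (sup_norm (derive1 P)) => [M||]; last 2 first.
- by rewrite leey.
- by have := supP' 0; rewrite ME.
have P'M x : `|derive1 P x| <= M by rewrite -lee_fin -ME.
have M0 : 0 <= M by apply: le_trans (P'M 0).
have lip a b : `|P b - P a| <= M * `|b - a|.
  wlog ab : a b / a <= b.
    move=> H; case: (leP a b) => [/H//|/ltW /H].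
    by rewrite distrC [in `|a - b|]distrC.
  have [||t _ ->] := @MVT_segment R P (derive1 P) a b ab.
  - move=> t _; have := dP t; rewrite derive1E; exact: derivableP.
  - apply: derivable_within_continuous => t _; exact: dP.
  by rewrite normrM ler_wpM2r.
have ND : N <= M * D.
  rewrite -lee_fin -NE; apply: ge_ereal_sup => _ [x _ <-].
  rewrite lee_fin; have [y [z [xy z0 yz]]] := Pnear x.
  apply: (le_trans xy); have := lip z y; rewrite z0 subr0 => /le_trans; apply.
  exact: ler_wpM2l.
rewrite lee_fin; apply: (le_trans (ler_wpM2l c0 ND)).
by rewrite mulrCA ler_piMr.
Qed.

(** * A product with prescribed zeros, as an element of the span *)

(** Twice the hyperbolic sine. *)
Definition dsinh {R : realType} (t : R) : R := expR t - expR (- t).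

Lemma dsinhN {R : realType} (t : R) : dsinh (- t) = - dsinh t.
Proof. by rewrite /dsinh opprK opprB. Qed.

Lemma dsinh0 {R : realType} : dsinh 0 = 0 :> R.
Proof. by rewrite /dsinh oppr0 subrr. Qed.

Lemma dsinh_gt0 {R : realType} (t : R) : 0 < t -> 0 < dsinh t.
Proof. by move=> t0; rewrite subr_gt0 ltr_expR; lra. Qed.

Definition zero_pos {R : realType} (lambda : R) (j : nat) : R :=
  lambda * (2 * j%:R + 1).

(** Up to the factor e^(lambda (x - z)), [dsinh (lambda * (x - z))] is affine in y = e^(-2 lambda
    x), and it vanishes only at z. Pairing the zeros z and -z makes the product even. *)
Definition zprod {R : realType} (lambda : R) (n : nat) (x : R) : R :=
  \prod_(j < n) (dsinh (lambda * (x - zero_pos lambda j)) *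
                 dsinh (lambda * (x + zero_pos lambda j))).

(** The factor of index j is (Y - e^(2 lambda z)) (Y - e^(-2 lambda z)) with z =
    [zero_pos lambda j]: its roots are the values of y = e^(-2 lambda x) at x = -z and x = z. *)
Definition zpoly {R : realType} (lambda : R) (n : nat) : {poly R} :=
  \prod_(j < n) ('X^2
    - (expR (2 * lambda * zero_pos lambda j)
       + expR (- (2 * lambda * zero_pos lambda j))) *: 'X + 1).

Lemma size_zpoly {R : realType} (lambda : R) (n : nat) :
  (size (zpoly lambda n) <= (2 * n).+1)%N.
Proof.
elim: n => [|n IHn]; first by rewrite /zpoly big_ord0 size_poly1.
rewrite /zpoly big_ord_recr /=; set q := (X in _ * X).
apply: (leq_trans (size_polyMleq _ _)).
have sq : (size q <= 3)%N.
  rewrite (leq_trans (size_polyD _ _))// geq_max size_poly1 andbT.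
  rewrite (leq_trans (size_polyD _ _))// geq_max size_polyXn/= size_polyN.
  by rewrite (leq_trans (size_scale_leq _ _))// size_polyX.
apply: (@leq_trans ((2 * n).+1 + 3).-1); last by lia.
by rewrite -!subn1 leq_sub2r// leq_add.
Qed.

Lemma zprod_horner {R : realType} (lambda : R) (n : nat) (x : R) :
  zprod lambda n x
  = expR (2 * lambda * n%:R * x) * (zpoly lambda n).[expR (- (2 * lambda * x))].
Proof.
have -> : expR (2 * lambda * n%:R * x) = \prod_(j < n) expR (2 * lambda * x).
  by rewrite prodr_const card_ord -expRM_natr; congr expR; ring.
rewrite /zprod /zpoly horner_prod -big_split/=.
apply: eq_bigr => j _; rewrite /dsinh.
rewrite !hornerD hornerN hornerZ hornerXn hornerX hornerC.
(* The factors agree because dsinh(a - b) dsinh(a + b) = e^(2a) + e^(-2a) - e^(2b) - e^(-2b). *)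
set a := lambda * x; set b := lambda * zero_pos lambda j.
have -> : lambda * (x - zero_pos lambda j) = a - b by rewrite /a /b; ring.
have -> : lambda * (x + zero_pos lambda j) = a + b by rewrite /a /b; ring.
have -> : 2 * lambda * zero_pos lambda j = b + b by rewrite /b; ring.
have -> : 2 * lambda * x = a + a by rewrite /a; ring.
rewrite !opprD opprK !expRD !expRN.
have := expR_gt0 a; have := expR_gt0 b.
by move=> /lt0r_neq0 ? /lt0r_neq0 ?; field; apply/andP.
Qed.

Lemma zprod_span {R : realType} (lambda : R) (n : nat) :
  gauss_span n lambda (fun x => phi x * zprod lambda n x).
Proof.
(* Expanding the square, phi(x + lambda k) = phi(x) e^(-2 lambda k x) e^(-lambda^2 k^2); the witness
   cancels the last factor, and y^(k + n) e^(2 lambda n x) is the middle one. *)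
exists (fun k => (zpoly lambda n)`_(absz (k + n%:Z)) *
                 expR (lambda ^+ 2 * k%:~R ^+ 2)).
apply/funext => x.
rewrite zprod_horner (horner_coef_wide _ (size_zpoly lambda n)).
rewrite !mulr_sumr; apply: eq_bigr => i _.
rewrite subrK absz_nat -expRM_natl /phi -[RHS]mulrA -expRD mulrA.
rewrite mulrCA -!expRD; congr (_ * expR _).
by rewrite rmorphB/= -!pmulrn; ring.
Qed.

Lemma zprodN {R : realType} (lambda : R) (n : nat) (x : R) :
  zprod lambda n (- x) = zprod lambda n x.
Proof.
apply: eq_bigr => j _.
rewrite -opprD [- x + _]addrC -[_ - x]opprB !mulrN !dsinhN mulrNN.
exact: mulrC.
Qed.

Lemma zprod_zero {R : realType} (lambda : R) (n j : nat) :
  (j < n)%N -> zprod lambda n (zero_pos lambda j) = 0.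
Proof.
by move=> jn; rewrite /zprod (bigD1 (Ordinal jn))//= subrr mulr0 dsinh0 !mul0r.
Qed.

Lemma zprod_neq0 {R : realType} (lambda : R) (n : nat) :
  0 < lambda -> zprod lambda n 0 != 0.
Proof.
move=> l0; rewrite prodf_seq_neq0; apply/allP => j _ /=.
have z0 : 0 < zero_pos lambda j by rewrite mulr_gt0// ltr_wpDl// mulr_ge0.
rewrite sub0r add0r mulrN dsinhN mulNr oppr_eq0 mulf_neq0// gt_eqF// dsinh_gt0//.
all: exact: mulr_gt0.
Qed.

(* Translation by [2 * lambda] maps the set of zeros to itself up to one zero
   at each end, so the product telescopes. *)
Lemma zprod_shift {R : realType} (lambda : R) (n : nat) (x : R) :
  zprod lambda n x * dsinh (lambda * (x - lambda * (2 * n%:R + 1)))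
  = zprod lambda n (x - 2 * lambda)
    * dsinh (lambda * (x + lambda * (2 * n%:R - 1))).
Proof.
elim: n => [|n IHn].
  by rewrite /zprod !big_ord0 !mul1r; congr (dsinh _); ring.
rewrite {1}/zprod big_ord_recr /= -/(zprod lambda n x).
rewrite [zprod lambda n x * _]mulrA [zprod lambda n x * _]IHn.
(* Shifted by 2 lambda, the two new factors on the right are the end factor on the left and the one
   produced by the induction hypothesis. *)
rewrite [in RHS]/zprod big_ord_recr /= -/(zprod lambda n (x - 2 * lambda)).
rewrite /zero_pos -(natr1 n).
have -> : x - 2 * lambda - lambda * (2 * n%:R + 1)
        = x - lambda * (2 * (n%:R + 1) + 1) by ring.
have -> : x - 2 * lambda + lambda * (2 * n%:R + 1)
        = x + lambda * (2 * n%:R - 1) by ring.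
have -> : lambda * (2 * (n%:R + 1) - 1) = lambda * (2 * n%:R + 1) by ring.
ring.
Qed.

(** * Decay beyond the last zero, and distance to the zeros *)

(** By [zprod_shift] the claim reduces to [key]. There v - u = 4 lambda^2 n, so the ratio of the
    [dsinh] terms is about e^(4 lambda^2 n), while the gaussian gains at least e^(8 lambda^2 n). *)
Lemma gauss_zprod_shift {R : realType} (lambda : R) (n : nat) (x : R) :
  0 < lambda -> 1 <= lambda ^+ 3 * n%:R ->
  lambda * (2 * n%:R + 3) <= x ->
  `|phi x * zprod lambda n x|
  <= `|phi (x - 2 * lambda) * zprod lambda n (x - 2 * lambda)|.
Proof.
move=> l0 ln xn.
set u := lambda * (x - lambda * (2 * n%:R + 1)).
set v := lambda * (x + lambda * (2 * n%:R - 1)).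
have u0 : 0 < u by rewrite mulr_gt0//; nra.
have v0 : 0 < v.
  rewrite mulr_gt0//; have : 0 <= lambda * n%:R by rewrite mulr_ge0// ltW.
  nra.
have du := dsinh_gt0 _ u0; have dv := dsinh_gt0 _ v0.
have key : phi x * dsinh v <= phi (x - 2 * lambda) * dsinh u.
  have lu : lambda ^+ 2 * 2 <= u by rewrite /u; nra.
  set m := lambda ^+ 2 * n%:R.
  have m0 : 0 <= m by rewrite mulr_ge0// sqr_ge0.
  have E1 : phi (x - 2 * lambda)
      = phi x * expR (4 * lambda * x - 4 * lambda ^+ 2).
    by rewrite /phi -expRD; congr expR; ring.
  rewrite E1 -mulrA ler_wpM2l ?phi_ge0//.
  set t := 4 * lambda ^+ 2.
  have t0 : 0 <= t by rewrite mulr_ge0// sqr_ge0.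
  have lx : 8 * m + 2 * t <= 4 * lambda * x - 4 * lambda ^+ 2.
    by rewrite /m /t; nra.
  have -> : v = u + 4 * m by rewrite /u /v /m; ring.
  apply: (@le_trans _ _ (expR (8 * m + 2 * t) * dsinh u)); last first.
    by rewrite ler_wpM2r ?(ltW du)// ler_expR.
  apply: (@le_trans _ _ (expR (u + 4 * m))).
    by rewrite lerBlDr lerDl expR_ge0.
  have -> : expR (8 * m + 2 * t) * dsinh u
      = expR (u + 4 * m)
        * (expR (2 * m) ^+ 2 * (expR t * (expR t * (1 - expR (- (2 * u)))))).
    rewrite /dsinh -expRM_natr.
    have -> : expR (- u) = expR u * expR (- (2 * u)).
      by rewrite -expRD; congr expR; ring.
    have -> : expR (8 * m + 2 * t) =
        expR (4 * m) * expR (2 * m * 2) * expR t * expR t.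
      by rewrite -!expRD; congr expR; ring.
    by rewrite expRD; ring.
  (* The surplus factor must be at least 1. For small t the part in t is only of order t = 4
     lambda^2, so e^(4m) is bounded below quadratically, to reach a power of lambda^3 n. *)
  rewrite ler_peMr ?expR_ge0//.
  have em : (2 * m) ^+ 2 <= expR (2 * m) ^+ 2.
    rewrite lerXn2r ?nnegrE ?expR_ge0//; first lra.
    by apply: le_trans (expR_ge1Dx _); rewrite lerDr.
  have et : t <= expR t * (expR t * (1 - expR (- (2 * u)))).
    have h : t <= expR t * (1 - expR (- (2 * u))).
      (* Here 2u >= t, and e^t (1 - e^(-t)) = e^t - 1 >= t. *)
      apply: (@le_trans _ _ (expR t * (1 - expR (- t)))).
        rewrite mulrBr mulr1 -expRD subrr expR0 lerBrDl; exact: expR_ge1Dx.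
      rewrite ler_wpM2l ?expR_ge0// lerB// ler_expR /t; lra.
    apply: (le_trans h); rewrite ler_peMl ?(le_trans t0)//.
    by rewrite -expR0 ler_expR.
  apply: (@le_trans _ _ ((2 * m) ^+ 2 * t)); last by rewrite ler_pM ?sqr_ge0.
  have -> : (2 * m) ^+ 2 * t = 16 * (lambda ^+ 3 * n%:R) ^+ 2.
    by rewrite /m /t; ring.
  have := exprn_ege1 2 ln; lra.
have px := phi_ge0 x; have ph := phi_ge0 (x - 2 * lambda).
rewrite !normrM (ger0_norm px) (ger0_norm ph) -(ler_pM2r du) -mulrA.
rewrite -{1}(gtr0_norm du) -normrM zprod_shift normrM (gtr0_norm dv).
rewrite mulrCA [leRHS]mulrAC [leRHS]mulrC.
exact: ler_wpM2l.
Qed.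

Lemma gauss_zprod_near {R : realType} (lambda : R) (n : nat) (x : R) :
  0 < lambda -> 1 <= lambda ^+ 3 * n%:R ->
  exists y z, [/\ `|phi x * zprod lambda n x| <= `|phi y * zprod lambda n y|,
    phi z * zprod lambda n z = 0 & `|y - z| <= 4 * lambda].
Proof.
move=> l0 ln.
have n0 : (0 < n)%N.
  by rewrite lt0n; apply: contraTneq ln => ->; rewrite mulr0 ler10.
wlog x0 : x / 0 <= x.
  move=> H; case: (leP 0 x) => [/H//|xn].
  have /H : 0 <= - x by lra.
  by rewrite phiN zprodN.
(* The largest zero is lambda (2m + 1), exactly 4 lambda below the right end of the interval; this
   fixes the constant 4. *)
have near_zero m y : 0 <= y -> y <= lambda * (2 * m.+1%:R + 3) ->
    exists2 j, (j < m.+1)%N & `|y - zero_pos lambda j| <= 4 * lambda.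
  elim: m y => [|m IHm] y y0; rewrite -[_.+1%:R]natr1 => yle.
    by exists 0%N => //; rewrite ler_norml /zero_pos; nra.
  have [yl|yg] := leP y (lambda * (2 * m.+1%:R + 3)).
    by have [j jm jy] := IHm y y0 yl; exists j => //; exact: ltnW.
  exists m.+1 => //; rewrite ler_norml /zero_pos; nra.
(* [k] bounds the number of translations by -2 lambda that bring [y] back to the interval. *)
have bounded (k : nat) y : 0 <= y -> y <= lambda * (2 * n%:R + 3 + 2 * k%:R) ->
    exists y', [/\ `|phi y * zprod lambda n y| <= `|phi y' * zprod lambda n y'|,
      0 <= y' & y' <= lambda * (2 * n%:R + 3)].
  elim: k y => [|k IHk] y y0; first by rewrite mulr0 addr0; exists y.
  rewrite -[_.+1%:R]natr1 => yle.
  have [yl|yg] := leP y (lambda * (2 * n%:R + 3)); first by exists y.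
  have ln0 : 0 <= lambda * n%:R by rewrite mulr_ge0// ltW.
  have [||y' [yy' y'0 y'le]] := IHk (y - 2 * lambda); [nra|nra|].
  exists y'; split => //; apply: le_trans yy'.
  by apply: gauss_zprod_shift => //; exact: ltW.
have [|y [xy y0 yle]] := bounded (Num.truncn (x / lambda)).+1 x x0.
  have : x / lambda < (Num.truncn (x / lambda)).+1%:R.
    by apply: truncnS_gt.
  rewrite ltr_pdivrMr// => ?.
  have ln0 : 0 <= lambda * n%:R by rewrite mulr_ge0// ltW.
  nra.
case: n n0 ln {bounded} xy yle => // m _ _ xy yle.
have [j jm jy] := near_zero m y y0 yle.
by exists y, (zero_pos lambda j); rewrite zprod_zero// mulr0.
Qed.

(** The constant in front is at least 1, and the exponential is at least lambda^(-4), so n >=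
    lambda^(-3). *)
Lemma lambda3n_ge1 {R : realType} (n : nat) (lambda : R) : 0 < lambda ->
  (1280 / (3 * pi)) * lambda * expR (pi ^+ 2 / (2 * lambda ^+ 2)) < n%:R ->
  1 <= lambda ^+ 3 * n%:R.
Proof.
move=> l0 hn.
have p2 : 2 <= pi :> R := pi_ge2 R.
have p4 : pi <= 4 :> R by have := pihalf_lt2 R; lra.
have C1 : 1 <= 1280 / (3 * pi) :> R by rewrite ler_pdivlMr; lra.
have e2 : lambda ^- 4 <= expR (pi ^+ 2 / (2 * lambda ^+ 2)).
  (* Halving the exponent and squaring turns e^s >= 1 + s into a quadratic bound; s = (pi / 2)^2 /
     lambda^2 >= lambda^(-2) since pi >= 2. *)
  have -> : pi ^+ 2 / (2 * lambda ^+ 2) = (pi / 2) ^+ 2 / lambda ^+ 2 * 2%:R.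
    by field; lra.
  rewrite expRM_natr (_ : lambda ^- 4 = (lambda ^- 2) ^+ 2); last first.
    by rewrite exprVn -exprM.
  rewrite lerXn2r ?nnegrE ?expR_ge0// ?invr_ge0 ?exprn_ge0 ?(ltW l0)//.
  apply: le_trans (expR_ge1Dx _).
  apply: (@le_trans _ _ ((pi / 2) ^+ 2 / lambda ^+ 2)); last lra.
  rewrite ler_peMl ?invr_ge0 ?exprn_ge0 ?(ltW l0)//; nra.
have nge : lambda * lambda ^- 4 <= n%:R.
  apply: le_trans (ltW hn); rewrite ler_pM ?invr_ge0 ?exprn_ge0 ?(ltW l0)//.
  by rewrite ler_peMl// ltW.
have E : lambda ^+ 3 * (lambda * lambda ^- 4) = 1 by field; lra.
by rewrite -[leLHS]E ler_pM2l// exprn_gt0.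
Qed.

Theorem theorem2 (R : realType) (n : nat) (lambda : R)
    (hlambda0 : 0 < lambda) (hlambda1 : lambda < 1)
    (hn : (1280 / (3 * pi)) * lambda * expR (pi ^+ 2 / (2 * lambda ^+ 2))
            < n%:R) :
  exists P : R -> R,
    [/\ gauss_span n lambda P,
        (exists x : R, P x != 0) &
        ((pi ^+ 2 / (2 ^+ 10 * lambda))%:E
           <= sup_norm (derive1 P) / sup_norm P)%E].
Proof.
have P_span := zprod_span lambda n.
have P_neq0 : exists x : R, phi x * zprod lambda n x != 0.
  by exists 0; rewrite mulf_neq0 ?zprod_neq0 ?gt_eqF ?expR_gt0.
exists (fun x => phi x * zprod lambda n x); split=> //.
have [B PB] := gauss_span_bounded P_span.
apply: (sup_norm_le_derive (D := 4 * lambda) _ _ _ PB P_neq0) => [||x|x].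
- by rewrite divr_ge0 ?sqr_ge0// mulr_ge0// ltW.
- have p2 : 2 <= pi :> R := pi_ge2 R.
  have p4 : pi <= 4 :> R by have := pihalf_lt2 R; lra.
  have -> : pi ^+ 2 / (2 ^+ 10 * lambda) * (4 * lambda) = pi ^+ 2 / 256.
    by field; lra.
  nra.
- exact: gauss_span_derivable P_span.
- exact: gauss_zprod_near _ _ _ hlambda0 (lambda3n_ge1 _ _ hlambda0 hn).
Qed.
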